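(* Let $A_\theta$ be the noncommutative two-torus and let $a_1,a_2\in A_\theta^\infty$ be positive invertible elements. Equip $\chi_\theta=(A_\theta^\infty)^2$ with the diagonal metric $\langle\partial_j,\partial_k\rangle=g_{jk}=\delta_{jk}a_k$ ($j,k\in\{1,2\}$), let $\nabla$ be the associated Rosenberg Levi-Civita connection, and let $R_{1,2,1,2}=\langle R(\partial_1,\partial_2)\partial_1,\partial_2\rangle$, where $R$ is the curvature form of $\nabla$. Suppose that at least one of the following holds: (i) for each $j\in\{1,2\}$, $a_j$ commutes with both $\partial_1a_j$ and $\partial_2a_j$ ($a_1$ and $a_2$ need not commute with each other); (ii) $a_1a_2=1$. Then the Riemannian integral of the associated Gaussian curvature vanishes, i.e. $$\tau\left(a_1^{-1/2}\,R_{1,2,1,2}\,a_2^{-1/2}\right)=0,$$ where $\tau$ is the unique faithful tracial state of $A_\theta$.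
   Context: Noncommutative two-torus: $A_\theta$ is the universal C*-algebra generated by unitaries $u_1,u_2$ with $u_1u_2=e^{2\pi i\theta}u_2u_1$, $\theta\in\mathbb R$. $A_\theta^\infty$ is the dense unital *-subalgebra of smooth vectors for the canonical $\mathbb T^2$-action (closed under holomorphic functional calculus, so $a^{\pm1/2}\in A_\theta^\infty$ for positive invertible $a\in A_\theta^\infty$), and $\partial_1,\partial_2$ are the associated commuting partial derivatives ($\partial_ju_k=2\pi i\,\delta_{jk}u_k$), which are *-derivations of $A_\theta^\infty$. $\tau$ is the canonical ($\mathbb T^2$-invariant) tracial state. Standing assumption: $\theta$ is ''generically transcendental'', which is used in the following form: $A_\theta$ is simple, and the real Lie algebra $\mathcal D_\theta$ (with commutator bracket) of all *-derivations $A_\theta^\infty\to A_\theta^\infty$ is the $\mathbb R$-linear span of $\partial_1,\partial_2$ and the inner *-derivations. The inner *-derivations are exactly $\operatorname{ad}_{\tilde a}:b\mapsto\tilde ab-b\tilde a$ for a unique skew-adjoint $\tilde a\in A_\theta^\infty$ with $\tau(\tilde a)=0$. For $X\in\mathcal D_\theta$, $a\in A_\theta^\infty$, write $X\cdot a=X(a)$. $\chi_\theta=(A_\theta^\infty)^2$ is the free left $A_\theta^\infty$-module whose standard basis vectors are also denoted $\partial_1,\partial_2$. A Riemannian metric is given by a positive invertible matrix $(g_{jk})\in M_2(A_\theta^\infty)$ with self-adjoint entries, via $\langle\sum_jb_j\partial_j,\sum_kc_k\partial_k\rangle=\sum_{j,k}b_jg_{jk}c_k^*$. Connection: an $\mathbb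 R$-bilinear map $\nabla:\mathcal D_\theta\times\chi_\theta\to\chi_\theta$, $(X,Y)\mapsto\nabla_XY$, with $\nabla_X(aY)=(X\cdot a)Y+a\nabla_XY$. Rosenberg's Levi-Civita connection of the metric is the unique connection (its existence and uniqueness is a theorem of Rosenberg) such that: (1) $X\cdot\langle Y,Z\rangle=\langle\nabla_XY,Z\rangle+\langle Y,\nabla_XZ\rangle$ for all $X\in\mathcal D_\theta$, $Y,Z\in\chi_\theta$; (2) $\nabla_{\partial_j}\partial_k=\nabla_{\partial_k}\partial_j$ for all $j,k$; (3) $\langle\nabla_{\partial_j}\partial_k,\partial_l\rangle$ is self-adjoint for all $j,k,l$; (4) $\nabla_{\operatorname{ad}_{\tilde a}}Y=\tilde aY$ for every skew-adjoint $\tilde a\in A_\theta^\infty$ with $\tau(\tilde a)=0$. It is determined on the $\partial_j$ by Rosenberg's formula $\langle\nabla_{\partial_j}\partial_k,\partial_l\rangle=\tfrac12(\partial_jg_{kl}+\partial_kg_{jl}-\partial_lg_{jk})$. Curvature form: $R(X,Y):=\nabla_Y\nabla_X-\nabla_X\nabla_Y+\nabla_{[X,Y]}$ for $X,Y\in\mathcal D_\theta$; in particular $R(\partial_1,\partial_2)=\nabla_{\partial_2}\nabla_{\partial_1}-\nabla_{\partial_1}\nabla_{\partial_2}$. For the diagonal metric, the Gaussian curvature is $K:=a_1^{-1}R_{1,2,1,2}a_2^{-1}$ and its Riemannian integral is $\tau(\sqrt{a_1}\,K\sqrt{a_2})=\tau(a_1^{-1/2}R_{1,2,1,2}a_2^{-1/2})$.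 *)

(* Defs.v *)
From HB Require Import structures.
From mathcomp Require Import all_boot all_order all_algebra.
From mathcomp Require Import all_classical all_reals.
From mathcomp Require Import interval_inference topology normedtype sequences derive trigo.
From mathcomp Require Import complex.
From mathcomp Require Import ring lra.
Set Implicit Arguments. Unset Strict Implicit. Unset Printing Implicit Defensive.
Import Order.TTheory GRing.Theory Num.Theory.
Import numFieldNormedType.Exports.
Local Open Scope classical_set_scope.
Local Open Scope ring_scope.
Local Open Scope complex_scope.

(* A [normedModType] cannot carry a ring structure in the same hierarchy, so the
   norm of a C*-algebra is a separate operation [cnorm], and [real_space A] is the
   underlying real normed space, on which limits and derivatives are taken. *)
HB.mixin Record isPreCStar (R : realType) A of GRing.Algebra R[i] A := {
  star : A -> A;
  cnorm : A -> R;
  starK : involutive star;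
  starD : {morph star : a b / a + b};
  starZ : forall (k : R[i]) a, star (k *: a) = k^* *: star a;
  starM : forall a b, star (a * b) = star b * star a;
  cnorm_eq0 : forall a, cnorm a = 0 -> a = 0;
  cnormD : forall a b, cnorm (a + b) <= cnorm a + cnorm b;
  cnormZ : forall (k : R[i]) a, cnorm (k *: a) = complex.Re `|k| * cnorm a;
  cnormM : forall a b, cnorm (a * b) <= cnorm a * cnorm b;
  cnorm_star_mul : forall a, cnorm (star a * a) = cnorm a ^+ 2
}.
#[short(type="preCStarType")]
HB.structure Definition PreCStar (R : realType) := {A of GRing.Algebra R[i] A & isPreCStar R A}.

Definition real_space (R : realType) (A : preCStarType R) : Type := A.

Section RealSpace.
Variables (R : realType) (A : preCStarType R).
Local Notation V := (real_space A).
HB.instance Definition _ := GRing.Zmodule.on V.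
Let scl (r : R) (x : V) : V := (r%:C *: (x : A)).
Fact sclA a b v : scl a (scl b v) = scl (a * b) v.
Proof. by rewrite /scl scalerA rmorphM. Qed.
Fact scl1 : left_id 1 scl. Proof. by move=> x; rewrite /scl rmorph1 scale1r. Qed.
Fact sclDr : right_distributive scl +%R. Proof. by move=> r x y; rewrite /scl scalerDr. Qed.
Fact sclDl v : {morph scl^~ v: a b / a + b}. Proof. by move=> r x; rewrite /scl rmorphD scalerDl. Qed.
HB.instance Definition _ := GRing.Zmodule_isLmodule.Build R V sclA scl1 sclDr sclDl.
Fact rnZ (l : R) (x : V) : cnorm (l *: x : A) = `|l| * cnorm (x : A).
Proof. by rewrite [l *: x]/(l%:C *: (x : A)) cnormZ normc_def /= expr0n addr0 sqrtr_sqr. Qed.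
HB.instance Definition _ := Lmodule_isNormed.Build R V (@cnormD R A) rnZ (@cnorm_eq0 R A).
End RealSpace.
HB.mixin Record PreCStar_isComplete (R : realType) A of PreCStar R A := {
  cstar_complete : forall F : set_system (real_space A), ProperFilter F -> cauchy F -> cvg F }.
#[short(type="cstarType")]
HB.structure Definition CStar (R : realType) := {A of PreCStar R A & PreCStar_isComplete R A}.
HB.instance Definition _ R (A : cstarType R) := Uniform_isComplete.Build (real_space A) (@cstar_complete R A).

Section CStarTheory.
Variables (R : realType) (A : cstarType R).
Implicit Types a b x y h : A.
Local Notation cn := (@cnorm R A).

Lemma cnorm_realE (x : real_space A) : `|x| = cnorm (x : A). Proof. by []. Qed.
Lemma cnorm_ge0 x : 0 <= cn x.
Proof. by rewrite -(cnorm_realE (x : real_space A)). Qed.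
Lemma real_scaleE (r : R) (x : real_space A) : r *: x = r%:C *: (x : A). Proof. by []. Qed.
Lemma star_additive : {morph @star R A : a b / a - b}.
Proof.
by move=> a b; rewrite starD -[- b]scaleN1r starZ rmorphN rmorph1 scaleN1r.
Qed.
Lemma star0 : star (0 : A) = 0. Proof. by have := star_additive 0 0; rewrite !subrr. Qed.
Lemma starN a : star (- a) = - star a. Proof. by rewrite -sub0r star_additive star0 sub0r. Qed.
Lemma star1 : star (1 : A) = 1.
Proof. by rewrite -[LHS]mulr1 -{2}[1]starK -starM mulr1 starK. Qed.
Lemma cnorm1_le : cn 1 <= 1.
Proof.
have := cnorm_star_mul (1 : A); rewrite star1 mulr1 => e.
have [->//|n0] := eqVneq (cn 1) 0.
by rewrite -(mulfI n0 (_ : cn 1 * 1 = cn 1 * cn 1)) // mulr1 [LHS]e expr2.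
Qed.
Lemma cnorm_star a : cn (star a) = cn a.
Proof.
have H b : cn b <= cn (star b).
  have := cnormM (star b) b; rewrite cnorm_star_mul expr2.
  have [->|n0] := eqVneq (cn b) 0; first by rewrite cnorm_ge0.
  by rewrite ler_pM2r // lt_def n0 cnorm_ge0.
by apply/le_anti; rewrite H -{2}[a]starK H.
Qed.
Lemma cnormZr (r : R) a : cn (r%:C *: a) = `|r| * cn a.
Proof. exact: (normrZ r (a : real_space A)). Qed.
Lemma cnormN a : cn (- a) = cn a.
Proof. exact: (normrN (a : real_space A)). Qed.

(* [y = (h^2 + y^2) / 2] has a solution, so that [(1 - y)^2 = 1 - h^2] *)
Lemma half_fixpoint h : star h = h -> cn h < 1 -> exists y,
  [/\ star y = y, y * h = h * y & y + y = h * h + y * y].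
Proof.
move=> hs h1.
have n0 := cnorm_ge0 h.
have n0' : `|cn h| = cn h by rewrite ger0_norm.
set q := cn h in h1 n0 n0'.
pose V := real_space A.
pose f (y : V) : V := ((2^-1 : R)%:C *: ((h * h + (y : A) * (y : A)) : A)).
pose U : set V := [set y | cn (y : A) <= q].
have f2 (y : V) : (f y : A) + f y = h * h + (y : A) * y.
  rewrite /f -scalerDl -rmorphD /=.
  by rewrite (_ : 2^-1 + 2^-1 = 1) ?rmorph1 ?scale1r //; lra.
have fU : set_fun U U f.
  move=> y /= yq; change (cnorm (f y : A) <= q); rewrite cnormZr gtr0_norm ?invr_gt0 //.
  rewrite mulrC ler_pdivrMr //.
  have /le_trans-> // := cnormD (h * h) ((y : A) * (y : A)).
  have := cnormM h h; have := cnormM (y : A) y.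
  rewrite -!/q => A1 A2.
  have : cn (y : A) * cn (y : A) <= q * q by apply: ler_pM => //; apply: cnorm_ge0.
  have : q * q <= q by rewrite ler_piMr // ltW.
  lra.
have ctr (x y : V) : U x -> U y -> cn (f x - f y : A) <= q * cn (x - y : A).
  move=> /= xq yq.
  have -> : (f x - f y : A) = (2^-1 : R)%:C *: (((x : A) - y) * (x : A) + (y : A) * ((x : A) - y)).
    rewrite /f -scalerBr; congr (_ *: _).
    by rewrite mulrBl mulrBr addrA subrK opprD addrACA subrr add0r.
  rewrite cnormZr gtr0_norm ?invr_gt0 // mulrC ler_pdivrMr //.
  apply: le_trans (cnormD _ _) _.
  have := cnormM ((x : A) - y) x; have := cnormM (y : A) ((x : A) - y).
  set z := (x : A) - y.
  have : cn z * cn (x : A) <= cn z * q by rewrite ler_wpM2l // cnorm_ge0.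
  have : cn (y : A) * cn z <= q * cn z by rewrite ler_wpM2r // cnorm_ge0.
  lra.
have Uc : closed U.
  have -> : U = closed_ball_ Num.norm (0 : V) q.
    by apply/seteqP; split=> y; rewrite /closed_ball_ /= sub0r normrN.
  exact: closed_closed_ball_.
have U0 : U !=set0 by exists 0; change (`|0 : V| <= q); rewrite normr0.
have [y Uy yE] : exists2 p, U p & p = f p.
  pose qn : {nonneg R} := NngNum n0.
  apply: (@banach_fixed_point R V U (mkfun fU)) => //.
  exists qn; split => // -[x y] /= [Ux Uy]; exact: ctr.
pose y' : A := y.
have yy : y' + y' = h * h + y' * y' by rewrite -f2 -yE.
have small (z : A) : cn (z + z) <= q * cn z + q * cn z -> z = 0.
  have -> : z + z = (2 : R)%:C *: z by rewrite -mulr2n -scaler_nat rmorph_nat.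
  rewrite cnormZr ger0_norm // => H; apply: cnorm_eq0; apply/eqP.
  have := cnorm_ge0 z; rewrite le_eqVlt eq_sym => /orP[//|z0].
  have : cn z < cn z by rewrite -(ltr_pM2l (ltr0n R 2)) (le_lt_trans H) // -mulrDl ltr_pM2r //; lra.
  by rewrite ltxx.
have yq : cn y' <= q by exact: Uy.
have tel (u v w : A) : u - v + (v - w) = u - w by rewrite addrA subrK.
exists y'; split => //.
- apply/eqP; rewrite -subr_eq0; apply/eqP; apply: small.
  have -> : (star y' - y') + (star y' - y') = star y' * (star y' - y') + (star y' - y') * y'.
    rewrite mulrBr mulrBl tel addrACA -opprD -starD !yy starD !starM hs.
    by rewrite opprD addrACA subrr add0r.
  apply: le_trans (cnormD _ _) _; apply: lerD; apply: le_trans (cnormM _ _) _.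
    by rewrite cnorm_star ler_wpM2r // cnorm_ge0.
  by rewrite mulrC ler_wpM2r // cnorm_ge0.
- apply/eqP; rewrite -subr_eq0; apply/eqP; apply: small.
  have -> : (y' * h - h * y') + (y' * h - h * y') = y' * (y' * h - h * y') + (y' * h - h * y') * y'.
    rewrite addrACA -opprD -mulrDl -mulrDr yy mulrDl mulrDr mulrBr mulrBl !mulrA tel.
    by rewrite opprD addrACA subrr add0r.
  apply: le_trans (cnormD _ _) _; apply: lerD; apply: le_trans (cnormM _ _) _.
    by rewrite ler_wpM2r // cnorm_ge0.
  by rewrite mulrC ler_wpM2r // cnorm_ge0.
Qed.
End CStarTheory.

(* Unital *-homomorphisms; they are automatically norm-decreasing, see
   [star_hom_contractive]. *)
Definition star_hom (R : realType) (A B : cstarType R) (phi : A -> B) :=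
  [/\ linear phi, monoid_morphism phi & forall a, phi (star a) = star (phi a)].

Lemma conj_real (R : realType) (r : R) : Num.conj (r%:C : R[i]) = r%:C.
Proof. exact: conjc_real. Qed.

Section StarHom.
Variables (R : realType) (A B : cstarType R) (phi : A -> B).
Hypothesis hphi : star_hom phi.
Lemma star_homD : {morph phi : a b / a + b}.
Proof. by case: hphi => l _ _ a b; rewrite -[a]scale1r l !scale1r. Qed.
Lemma star_hom0 : phi 0 = 0.
Proof. by apply: (addrI (phi 0)); rewrite -star_homD !addr0. Qed.
Lemma star_homZ k a : phi (k *: a) = k *: phi a.
Proof. by case: hphi => l _ _; rewrite -[k *: a]addr0 l star_hom0 addr0. Qed.
Lemma star_homB : {morph phi : a b / a - b}.
Proof. by move=> a b; rewrite star_homD -scaleN1r star_homZ scaleN1r. Qed.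
Lemma star_homM : {morph phi : a b / a * b}. Proof. by case: hphi => _ []. Qed.
Lemma star_hom1 : phi 1 = 1. Proof. by case: hphi => _ []. Qed.
Lemma star_homS a : phi (star a) = star (phi a). Proof. by case: hphi. Qed.

Lemma star_hom_sa_le (h : A) : star h = h -> cnorm h < 1 -> cnorm (phi h) <= 1.
Proof.
move=> hs h1; have [y [ys yh yy]] := half_fixpoint hs h1.
pose p := phi h; pose r := phi (1 - y).
have ps : star p = p by rewrite /p -star_homS hs.
have rs : star r = r by rewrite /r -star_homS star_additive star1 ys.
have pr : p * r = r * p.
  by rewrite /p /r -!star_homM mulrBl mulrBr mul1r mulr1 yh.
have e1 : p * p + r * r = 1.
  rewrite /p /r -!star_homM -star_homD -star_hom1; congr phi.
  rewrite mulrBl mul1r mulrBr mulr1 opprB addrA addrA.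
  by rewrite (addrC (h * h)) -(addrA (1 - y)) -yy addrA addrK subrK.
pose I : R[i] := 0 +i* 1.
have Ic : Num.conj I = - I.
  change (conjc I = - I); by apply/eqP; rewrite eq_complex /= oppr0 !eqxx.
have II : I * I = -1.
  by apply/eqP; rewrite eq_complex /= !(mul0r, mulr0, mulr1, addr0, sub0r) oppr0 !eqxx.
have U1 : star (p + I *: r) = p - I *: r.
  by rewrite starD starZ ps rs Ic scaleNr.
have nU : cnorm (p + I *: r) <= 1.
  have : cnorm (p + I *: r) ^+ 2 <= 1.
    rewrite -cnorm_star_mul U1 mulrBl !mulrDr -!scalerAl -!scalerAr scalerA pr.
    rewrite II scaleN1r opprD opprK addrA addrK e1.
    exact: cnorm1_le.
  by rewrite expr_le1 // cnorm_ge0.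
have : cnorm ((2 : R)%:C *: p) <= 2.
  have -> : (2 : R)%:C *: p = (p + I *: r) + star (p + I *: r).
    by rewrite U1 addrACA subrr addr0 -[RHS]mulr2n -[RHS]scaler_nat rmorph_nat.
  apply: le_trans (cnormD _ _) _; rewrite cnorm_star; lra.
by rewrite cnormZr ger0_norm // -[leRHS]mulr1 ler_pM2l.
Qed.

Lemma star_hom_contractive x : cnorm (phi x) <= cnorm x.
Proof.
suff : cnorm (phi x) ^+ 2 <= cnorm x ^+ 2 by rewrite ler_sqr ?nnegrE ?cnorm_ge0.
apply/ler_addgt0Pr => e e0.
set t := cnorm x ^+ 2 + e.
have t0 : 0 < t by rewrite ltr_wpDl // exprn_ge0 // cnorm_ge0.
have ti : `|t^-1| = t^-1 by rewrite gtr0_norm // invr_gt0.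
have := @star_hom_sa_le (t^-1%:C *: (star x * x)).
rewrite starZ (conj_real t^-1) starM starK star_homZ star_homM star_homS !cnormZr ti !cnorm_star_mul.
rewrite ![t^-1 * _]mulrC ltr_pdivrMr // ler_pdivrMr // !mul1r; apply => //.
by rewrite ltrDl.
Qed.
End StarHom.

Section SmoothFunctions.
Variable R : realType.
Local Notation e_ j := (delta_mx 0 j : 'rV[R]_2).

(* Functions on the plane that are of class C^n: all iterated partial derivatives
   of order at most [n] exist everywhere and are continuous. *)
Fixpoint class_C (W : normedModType R) (n : nat) (F : 'rV[R]_2 -> W) : Prop :=
  continuous F /\
  if n is m.+1 then
    forall j : 'I_2, (forall s, derivable F s (e_ j)) /\ class_C m (fun s => 'D_(e_ j) F s)
  else True.

Lemma class_CW (W : normedModType R) n (F : 'rV[R]_2 -> W) :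
  class_C n.+1 F -> class_C n F.
Proof.
elim: n F => [|n IH] F; first by case.
move=> [cF dF]; split=> // j; have [dFj CF] := dF j; split=> //; exact: IH.
Qed.

Lemma class_C_cont (W : normedModType R) n (F : 'rV[R]_2 -> W) :
  class_C n F -> continuous F.
Proof. by case: n => [|n] []. Qed.

Section RealLinear.
Variables (W W' : normedModType R) (L : W -> W').
Hypothesis Llin : linear L.
Hypothesis Lle : forall x, `|L x| <= `|x|.
Let LB x y : L (x - y) = L x - L y.
Proof. by rewrite addrC -scaleN1r Llin scaleN1r addrC. Qed.
Let L0 : L 0 = 0. Proof. by rewrite -(subrr 0) LB subrr. Qed.
Let LZ k x : L (k *: x) = k *: L x.
Proof. by rewrite -[k *: x]addr0 Llin L0 addr0. Qed.

Lemma le_norm_continuous : continuous L.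
Proof.
move=> x; apply/cvgrPdist_lt => e e0; near=> y.
rewrite -LB; apply: le_lt_trans (Lle _) _; near: y.
by apply: cvgr_dist_lt => //; apply: cvg_id.
Unshelve. all: by end_near. Qed.

Lemma is_derive_lin (F : 'rV[R]_2 -> W) s v :
  derivable F s v -> is_derive s v (L \o F) (L ('D_v F s)).
Proof.
move=> dF.
have H : (fun h : R => h^-1 *: ((L \o F \o shift s) (h *: v) - (L \o F) s)) @ 0^' --> L ('D_v F s).
  have -> : (fun h : R => h^-1 *: ((L \o F \o shift s) (h *: v) - (L \o F) s))
    = L \o (fun h : R => h^-1 *: ((F \o shift s) (h *: v) - F s)).
    by apply/funext => h /=; rewrite LZ LB.
  by apply: continuous_cvg; [exact: le_norm_continuous|exact: dF].
apply: DeriveDef; first by apply/cvg_ex; exists (L ('D_v F s)).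
exact/cvg_lim.
Qed.

Lemma class_C_lin n (F : 'rV[R]_2 -> W) : class_C n F -> class_C n (L \o F).
Proof.
elim: n F => [|n IH] F [cF dF]; split=> //.
- by move=> s; apply: continuous_comp; [exact: cF|exact: le_norm_continuous].
- by move=> s; apply: continuous_comp; [exact: cF|exact: le_norm_continuous].
- move=> j; have [dFj CF] := dF j; split; first by move=> s; have [] := is_derive_lin (dFj s).
  rewrite (_ : (fun s => _) = L \o (fun s => 'D_(e_ j) F s)); first exact: IH.
  by apply/funext => s /=; have [] := is_derive_lin (dFj s).
Qed.
End RealLinear.

Lemma class_C_cst (W : normedModType R) n (w : W) : class_C n (fun=> w).
Proof.
elim: n w => [|n IH] w; split=> //; try exact: cst_continuous.
move=> j; split; first by move=> s; exact: derivable_cst.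
have -> : (fun s => 'D_(e_ j) (fun=> w) s) = (fun=> 0) :> (_ -> W).
  by apply/funext => s; exact: derive_cst.
exact: IH.
Qed.

Lemma class_CD (W : normedModType R) n (F G : 'rV[R]_2 -> W) :
  class_C n F -> class_C n G -> class_C n (F \+ G).
Proof.
elim: n F G => [|n IH] F G [cF dF] [cG dG]; split=> //.
- by move=> s; exact: (cvgD (cF s) (cG s)).
- by move=> s; exact: (cvgD (cF s) (cG s)).
- move=> j; have [dFj CF] := dF j; have [dGj CG] := dG j; split.
    by move=> s; exact: derivableD.
  rewrite (_ : (fun s => _) = (fun s => 'D_(e_ j) F s) \+ (fun s => 'D_(e_ j) G s)); first exact: IH.
  by apply/funext => s; exact: deriveD.
Qed.

Section Product.
Variable A : cstarType R.
Local Notation V := (real_space A).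
Definition rmul (x y : V) : V := (x : A) * (y : A).

Lemma normr_rmul (x y : V) : `|rmul x y| <= `|x| * `|y|.
Proof. exact: cnormM. Qed.

Lemma cvg_rmul (T : Type) (P : set_system T) {FP : Filter P} (f g : T -> V) (a b : V) :
  f @ P --> a -> g @ P --> b -> (fun t => rmul (f t) (g t)) @ P --> rmul a b.
Proof.
move=> fa gb; apply/cvgrPdist_lt => e e0.
pose M := `|a| + `|b| + 1.
have M0 : 0 < M by rewrite ltr_wpDl ?addr_ge0.
near=> t.
have E : rmul a b - rmul (f t) (g t) = rmul (a - f t) b + rmul (f t) (b - g t).
  by rewrite /rmul mulrBl mulrBr addrA subrK.
have d1 : `|a - f t| < e / (2 * M).
  by near: t; move/cvgrPdist_lt : fa; apply; rewrite divr_gt0 // mulr_gt0.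
have d2 : `|b - g t| < e / (2 * M).
  by near: t; move/cvgrPdist_lt : gb; apply; rewrite divr_gt0 // mulr_gt0.
have d3 : `|f t| <= M.
  have : `|a - f t| < 1 by near: t; move/cvgrPdist_lt : fa; apply.
  have := ler_normD (f t - a) a; rewrite subrK distrC /M; have := normr_ge0 b; lra.
have d4 : `|b| <= M by rewrite /M; have := normr_ge0 a; lra.
rewrite E; apply: le_lt_trans (ler_normD _ _) _.
have e1 : `|rmul (a - f t) b| < e / 2.
  apply: le_lt_trans (normr_rmul _ _) _.
  have -> : e / 2 = e / (2 * M) * M by field; rewrite gt_eqF.
  apply: le_lt_trans (_ : `|a - f t| * M < _); first by rewrite ler_wpM2l.
  by rewrite ltr_pM2r.
have e2 : `|rmul (f t) (b - g t)| < e / 2.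
  apply: le_lt_trans (normr_rmul _ _) _.
  have -> : e / 2 = M * (e / (2 * M)) by field; rewrite gt_eqF.
  apply: le_lt_trans (_ : M * `|b - g t| < _); first by rewrite ler_wpM2r.
  by rewrite ltr_pM2l.
lra.
Unshelve. all: by end_near. Qed.

Lemma is_derive_rmul (F G : 'rV[R]_2 -> V) s v : continuous G ->
  derivable F s v -> derivable G s v ->
  is_derive s v (fun s => rmul (F s) (G s)) (rmul ('D_v F s) (G s) + rmul (F s) ('D_v G s)).
Proof.
move=> cG dF dG.
set H := fun s => _; set D := _ + _.
have HD : (fun h : R => h^-1 *: ((H \o shift s) (h *: v) - H s)) @ 0^' --> D.
  have -> : (fun h : R => h^-1 *: ((H \o shift s) (h *: v) - H s)) =
    (fun h : R => rmul (h^-1 *: ((F \o shift s) (h *: v) - F s)) ((G \o shift s) (h *: v)))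
    \+ (fun h : R => rmul (F s) (h^-1 *: ((G \o shift s) (h *: v) - G s))).
    apply/funext => h /=; rewrite /H /rmul !real_scaleE -scalerAl -scalerAr -scalerDr.
    by congr (_ *: _); rewrite mulrBl mulrBr addrA subrK.
  apply: cvgD.
    apply: cvg_rmul; first exact: dF.
    have hc : (fun h : R => h *: v + s) @ 0^' --> s.
      have e0 : s = (0 : R) *: v + s by rewrite scale0r add0r.
      rewrite [X in _ --> X]e0; apply: cvg_within_filter.
      by apply: cvgD; [apply: cvgZr_tmp; exact: cvg_id|exact: cvg_cst].
    by apply: continuous_cvg; [exact: cG|exact: hc].
  apply: cvg_rmul; [exact: cvg_cst|exact: dG].
apply: DeriveDef; first by apply/cvg_ex; exists D.
exact/cvg_lim.
Qed.

Lemma class_C_rmul_cont n (F G : 'rV[R]_2 -> V) :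
  class_C n F -> class_C n G -> continuous (fun s => rmul (F s) (G s)).
Proof.
move=> /class_C_cont cF /class_C_cont cG s.
exact: (@cvg_rmul _ _ _ _ _ _ _ (cF s) (cG s)).
Qed.

Lemma class_C_rmul n (F G : 'rV[R]_2 -> V) :
  class_C n F -> class_C n G -> class_C n (fun s => rmul (F s) (G s)).
Proof.
elim: n F G => [|n IH] F G CF CG.
  by split=> //; exact: class_C_rmul_cont CG.
split; first exact: class_C_rmul_cont CG.
have cG := class_C_cont CG.
move=> j; have [dFj CF'] := CF.2 j; have [dGj CG'] := CG.2 j; split.
  by move=> s; have [] := is_derive_rmul cG (dFj s) (dGj s).
rewrite (_ : (fun s => _) = (fun s => rmul ('D_(e_ j) F s) (G s)) \+ (fun s => rmul (F s) ('D_(e_ j) G s))).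
  by apply: class_CD; apply: IH => //; exact: class_CW.
by apply/funext => s; have [] := is_derive_rmul cG (dFj s) (dGj s).
Qed.

End Product.
End SmoothFunctions.

Section Torus.
Variable R : realType.

(* [cis x = e^{2 i pi x}] *)
Definition cis (x : R) : R[i] := cos (2 * pi * x) +i* sin (2 * pi * x).

Lemma cisD x y : cis (x + y) = cis x * cis y.
Proof.
apply/eqP; rewrite eq_complex /= mulrDr cosD sinD eqxx /=.
by rewrite addrC.
Qed.

Lemma cis0 : cis 0 = 1.
Proof. by rewrite /cis mulr0 cos0 sin0. Qed.

Lemma cis_conj x : Num.conj (cis x) = cis (- x).
Proof.
change (conjc (cis x) = cis (- x)).
by apply/eqP; rewrite eq_complex /= mulrN cosN sinN !eqxx.
Qed.

Lemma cisN x : cis x * cis (- x) = 1.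
Proof. by rewrite -cisD subrr cis0. Qed.

Definition unitary (A : cstarType R) (v : A) := star v * v = 1 /\ v * star v = 1.

Definition rotation_pair (theta : R) (A : cstarType R) (v : 'I_2 -> A) :=
  (forall j, unitary (v j)) /\
  v ord0 * v ord_max = cis theta *: (v ord_max * v ord0).

(* The universal C*-algebra on two unitaries [u_1, u_2], indexed by [ord0] and
   [ord_max], with [u_1 u_2 = e^{2 i pi theta} u_2 u_1]. *)
Record nctorus (theta : R) := NCTorus {
  nct_alg :> cstarType R;
  nct_gen : 'I_2 -> nct_alg;
  nct_gen_pair : rotation_pair theta nct_gen;
  nct_universal : forall (B : cstarType R) (v : 'I_2 -> B), rotation_pair theta v ->
    exists! phi : nct_alg -> B, star_hom phi /\ forall j, phi (nct_gen j) = v j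
}.
End Torus.

Section Action.
Variables (R : realType) (theta : R) (T : nctorus theta).
Local Notation u := (nct_gen T).
Implicit Types s t : 'rV[R]_2.

Lemma rotated_pair s : rotation_pair theta (fun j => cis (s 0 j) *: u j).
Proof.
have [uu uc] := nct_gen_pair T; split=> [j|].
  have [u1 u2] := uu j.
  by split; rewrite starZ cis_conj -scalerAl -scalerAr scalerA ?u1 ?u2 ?cisN ?[cis (- _) * _]mulrC ?cisN scale1r.
rewrite -!scalerAl -!scalerAr uc !scalerA; congr (_ *: _).
by rewrite [LHS]mulrC -[RHS]mulrA; congr (_ * _); rewrite mulrC.
Qed.

(* The automorphism [u_j |-> e^{2 i pi s_j} u_j]: the canonical action of the
   two-torus, parametrized by its universal cover. *)
Definition torus_act s : T -> T := sval (cid (nct_universal T (rotated_pair s))).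

Lemma torus_act_hom s : star_hom (torus_act s).
Proof. by rewrite /torus_act; case: cid => phi [[]]. Qed.

Lemma torus_act_gen s j : torus_act s (u j) = cis (s 0 j) *: u j.
Proof. by rewrite /torus_act; case: cid => phi /= [[_ H] _]; exact: H. Qed.

Lemma torus_act_unique s (phi : T -> T) : star_hom phi ->
  (forall j, phi (u j) = cis (s 0 j) *: u j) -> torus_act s = phi.
Proof.
move=> h1 h2; rewrite /torus_act; case: cid => psi /= [_ U].
exact: U.
Qed.

Lemma star_hom_id (A : cstarType R) : star_hom (@id A).
Proof. by split=> // a b c. Qed.

Lemma star_hom_comp (A B C : cstarType R) (f : A -> B) (g : B -> C) :
  star_hom f -> star_hom g -> star_hom (g \o f).
Proof.
move=> hf hg; split=> [k a b|//|a] /=.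
- by rewrite (star_homD hf) (star_homZ hf) (star_homD hg) (star_homZ hg).
- split=> [|a b] /=; first by rewrite (star_hom1 hf) (star_hom1 hg).
  by rewrite (star_homM hf) (star_homM hg).
- by rewrite (star_homS hf) (star_homS hg).
Qed.

Lemma torus_act0 : torus_act 0 = id.
Proof.
apply: torus_act_unique; first exact: star_hom_id.
by move=> j; rewrite mxE cis0 scale1r.
Qed.

Lemma torus_actD s t a : torus_act (s + t) a = torus_act s (torus_act t a).
Proof.
suff -> : torus_act (s + t) = torus_act s \o torus_act t by [].
apply: torus_act_unique; first exact: star_hom_comp (torus_act_hom t) (torus_act_hom s).
move=> j /=; rewrite torus_act_gen (star_homZ (torus_act_hom s)) torus_act_gen.
by rewrite scalerA mxE cisD mulrC.
Qed.

Definition orbit_map (a : T) : 'rV[R]_2 -> real_space T := fun s => torus_act s a.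
Definition smooth_vector (a : T) := forall n, class_C n (orbit_map a).

(* Since [d/dx cis x = 2 i pi] at [0], this gives [d_j u_k = 2 i pi delta_jk u_k]. *)
Definition nct_partial (j : 'I_2) (a : T) : T := 'D_(delta_mx 0 j) (orbit_map a) 0.

Lemma real_linear (A B : cstarType R) (phi : A -> B) : star_hom phi ->
  linear (phi : real_space A -> real_space B).
Proof. by move=> h k x y; rewrite !real_scaleE (star_homD h) (star_homZ h). Qed.

Lemma star_real_linear (A : cstarType R) : linear (@star R A : real_space A -> real_space A).
Proof. by move=> k x y; rewrite !real_scaleE starD starZ conj_real. Qed.

Lemma smooth_cst (c : R[i]) : smooth_vector c%:A.
Proof.
move=> n; rewrite (_ : orbit_map _ = fun=> c%:A); first exact: class_C_cst.
apply/funext => s.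
by rewrite /orbit_map (star_homZ (torus_act_hom s)) (star_hom1 (torus_act_hom s)).
Qed.

Lemma smoothD a b : smooth_vector a -> smooth_vector b -> smooth_vector (a + b).
Proof.
move=> sa sb n; rewrite (_ : orbit_map _ = orbit_map a \+ orbit_map b).
  exact: class_CD.
by apply/funext => s; rewrite /orbit_map (star_homD (torus_act_hom s)).
Qed.

Lemma orbit_mapM a b : orbit_map (a * b) = fun s => rmul (orbit_map a s) (orbit_map b s).
Proof. by apply/funext => s; rewrite /orbit_map (star_homM (torus_act_hom s)). Qed.

Lemma orbit_mapS a : orbit_map (star a) = (@star R T : real_space T -> real_space T) \o orbit_map a.
Proof. by apply/funext => s; rewrite /orbit_map (star_homS (torus_act_hom s)). Qed.

Lemma smoothM a b : smooth_vector a -> smooth_vector b -> smooth_vector (a * b).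
Proof. by move=> sa sb n; rewrite orbit_mapM; exact: class_C_rmul. Qed.

Lemma star_le (x : real_space T) : `|star (x : T) : real_space T| <= `|x|.
Proof. by rewrite !cnorm_realE cnorm_star. Qed.

Lemma smooth_vector_star a : smooth_vector a -> smooth_vector (star a).
Proof.
move=> sa n; rewrite orbit_mapS.
by apply: class_C_lin (sa n); [exact: star_real_linear|exact: star_le].
Qed.

Lemma smooth_vector_derivable a s j : smooth_vector a -> derivable (orbit_map a) s (delta_mx 0 j).
Proof. by move=> /(_ 1)[_ /(_ j)[]]. Qed.

Lemma orbit_map_partial j a : smooth_vector a ->
  orbit_map (nct_partial j a) = fun s => 'D_(delta_mx 0 j) (orbit_map a) s.
Proof.
move=> sa; apply/funext => s; rewrite /orbit_map /nct_partial.
have dF := @smooth_vector_derivable a 0 j sa.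
have [_ <-] := is_derive_lin (real_linear (torus_act_hom s)) (star_hom_contractive (torus_act_hom s)) dF.
rewrite /derive.
have E h : ((torus_act s \o orbit_map a) \o shift 0) h = (torus_act^~ a \o shift s) h.
  by rewrite /= /orbit_map -torus_actD addr0 addrC.
have E0 : (torus_act s \o orbit_map a) 0 = torus_act s a.
  by rewrite /= /orbit_map -torus_actD addr0.
by under eq_fun do rewrite E E0.
Qed.

Lemma smooth_vector_partial j a : smooth_vector a -> smooth_vector (nct_partial j a).
Proof.
move=> sa n; rewrite orbit_map_partial //.
by have [_ /(_ j)[]] := sa n.+1.
Qed.

Lemma nct_partialD j a b : smooth_vector a -> smooth_vector b ->
  nct_partial j (a + b) = nct_partial j a + nct_partial j b.
Proof.
move=> sa sb; rewrite /nct_partial (_ : orbit_map _ = orbit_map a + orbit_map b).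
  have da := @smooth_vector_derivable a 0 j sa.
  have db := @smooth_vector_derivable b 0 j sb.
  exact: (deriveD da db).
by apply/funext => s; rewrite /orbit_map (star_homD (torus_act_hom s)).
Qed.

Lemma nct_partialM j a b : smooth_vector a -> smooth_vector b ->
  nct_partial j (a * b) = nct_partial j a * b + a * nct_partial j b.
Proof.
move=> sa sb; rewrite /nct_partial orbit_mapM.
have da := @smooth_vector_derivable a 0 j sa.
have db := @smooth_vector_derivable b 0 j sb.
have [_ ->] := is_derive_rmul (class_C_cont (sb 0%N)) da db.
by rewrite /rmul /orbit_map torus_act0.
Qed.

Lemma nct_partialZ j (k : R[i]) a : smooth_vector a ->
  nct_partial j (k *: a) = k *: nct_partial j a.
Proof.
move=> sa; rewrite -[a in LHS]mul1r scalerAl nct_partialM //; last exact: smooth_cst.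
rewrite -scalerAl mul1r [X in X * _](_ : _ = 0) ?mul0r ?add0r //.
rewrite /nct_partial (_ : orbit_map _ = cst (k%:A : real_space T)); first exact: (derive_cst (k%:A : real_space T) (0 : 'rV[R]_2)).
apply/funext => s.
by rewrite /orbit_map (star_homZ (torus_act_hom s)) (star_hom1 (torus_act_hom s)).
Qed.

Lemma nct_partial_star j a : smooth_vector a ->
  nct_partial j (star a) = star (nct_partial j a).
Proof.
move=> sa; rewrite /nct_partial orbit_mapS.
have da := @smooth_vector_derivable a 0 j sa.
by have [_ ->] := is_derive_lin (@star_real_linear T) star_le da.
Qed.

Definition smooth_pred : {pred T} := [pred a | `[< smooth_vector a >]].
Lemma smoothP a : reflect (smooth_vector a) (a \in smooth_pred).
Proof. exact: asboolP. Qed.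

Fact smooth_subalg_closed : GRing.subalg_closed smooth_pred.
Proof.
have s1 : smooth_vector 1 by rewrite -[1]scale1r; exact: smooth_cst.
have sZ (c : R[i]) a : smooth_vector a -> smooth_vector (c *: a).
  by move=> sa; rewrite -[a]mul1r scalerAl; apply: smoothM => //; exact: smooth_cst.
split=> [|c a b|a b]; first exact/smoothP.
- by move=> /smoothP sa /smoothP sb; apply/smoothP/smoothD => //; exact: sZ.
- by move=> /smoothP sa /smoothP sb; apply/smoothP/smoothM.
Qed.
HB.instance Definition _ := GRing.isSubalgClosed.Build R[i] T smooth_pred smooth_subalg_closed.

Record smooth_torus := SmoothElt { smooth_val : T; _ : smooth_val \in smooth_pred }.
HB.instance Definition _ := [isSub for smooth_val].
HB.instance Definition _ := [Choice of smooth_torus by <:].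
HB.instance Definition _ := [SubChoice_isSubAlgebra of smooth_torus by <:].
End Action.

Section Derivations.
Variables (R : realType) (theta : R) (T : nctorus theta).
Local Notation Aoo := (smooth_torus T).
Implicit Types a b c : Aoo.

Definition smooth_star a : Aoo :=
  SmoothElt (introT (smoothP _) (smooth_vector_star (elimT (smoothP _) (valP a)))).
Definition smooth_partial (j : 'I_2) a : Aoo :=
  SmoothElt (introT (smoothP _) (smooth_vector_partial j (elimT (smoothP _) (valP a)))).

Lemma smooth_starD : {morph smooth_star : a b / a + b}.
Proof. by move=> a b; apply: val_inj; rewrite /= starD. Qed.
Lemma smooth_starZ (k : R[i]) a : smooth_star (k *: a) = k^*%R *: smooth_star a.
Proof. by apply: val_inj; rewrite /= starZ. Qed.
Lemma smooth_starM a b : smooth_star (a * b) = smooth_star b * smooth_star a.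
Proof. by apply: val_inj; rewrite /= starM. Qed.
Lemma smooth_starN a : smooth_star (- a) = - smooth_star a.
Proof. by apply: val_inj; rewrite /= starN. Qed.
Lemma smooth_starB : {morph smooth_star : a b / a - b}.
Proof. by move=> a b; rewrite smooth_starD smooth_starN. Qed.

Record star_derivation := StarDerivation {
  sder_fun :> Aoo -> Aoo;
  sder_linear : linear sder_fun;
  sderM : forall a b, sder_fun (a * b) = sder_fun a * b + a * sder_fun b;
  sder_star : forall a, sder_fun (smooth_star a) = smooth_star (sder_fun a)
}.
Implicit Types X Y : star_derivation.

Lemma sder_eq X Y : (forall a, X a = Y a) -> X = Y.
Proof.
case: X Y => [X l m s] [Y l' m' s'] /= /funext E.
by case: Y / E l' m' s' => l' m' s'; congr StarDerivation; exact: Prop_irrelevance.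
Qed.

Lemma sderD X : {morph X : a b / a + b}.
Proof. by move=> a b; rewrite -[a]scale1r sder_linear !scale1r. Qed.
Lemma sder0 X : X 0 = 0.
Proof. by apply: (addrI (X 0)); rewrite -sderD !addr0. Qed.
Lemma sderZ X (k : R[i]) a : X (k *: a) = k *: X a.
Proof. by rewrite -[k *: a]addr0 sder_linear sder0 addr0. Qed.
Lemma sderN X a : X (- a) = - X a.
Proof. by rewrite -scaleN1r sderZ scaleN1r. Qed.
Lemma sderB X : {morph X : a b / a - b}.
Proof. by move=> a b; rewrite sderD sderN. Qed.

Definition sder_zero : star_derivation.
Proof.
refine (@StarDerivation (fun=> 0) _ _ _) => [k a b|a b|a].
- by rewrite scaler0 addr0.
- by rewrite mul0r mulr0 addr0.
- by rewrite -[in RHS](subrr 0) smooth_starB subrr.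
Defined.

Definition sder_opp X : star_derivation.
Proof.
refine (@StarDerivation (fun a => - X a) _ _ _) => [k a b|a b|a].
- by rewrite sder_linear opprD scalerN.
- by rewrite sderM opprD mulNr mulrN.
- by rewrite sder_star smooth_starN.
Defined.

Definition sder_add X Y : star_derivation.
Proof.
refine (@StarDerivation (fun a => X a + Y a) _ _ _) => [k a b|a b|a].
- by rewrite !sder_linear addrACA scalerDr.
- by rewrite !sderM addrACA mulrDl mulrDr.
- by rewrite !sder_star smooth_starD.
Defined.

Definition sder_scale (r : R) X : star_derivation.
Proof.
refine (@StarDerivation (fun a => r%:C *: X a) _ _ _) => [k a b|a b|a].
- by rewrite sder_linear scalerDr !scalerA mulrC.
- by rewrite sderM scalerDr scalerAl scalerAr.
- by rewrite sder_star smooth_starZ conj_real.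
Defined.

Definition sder_bracket X Y : star_derivation.
Proof.
refine (@StarDerivation (fun a => X (Y a) - Y (X a)) _ _ _) => [k a b|a b|a].
- by rewrite !sder_linear scalerBr opprD addrACA.
- have E (p q r s t w : Aoo) : p + q + (r + s) - (t + r + (q + w)) = p - t + (s - w).
    rewrite (addrC r s) (addrACA p) (addrC q w) (addrACA t) (addrC r q) opprD.
    by rewrite (addrACA (p + s)) subrr addr0 opprD (addrACA p).
  by rewrite !sderM !sderD !sderM mulrBl mulrBr E.
- by rewrite !sder_star smooth_starB.
Defined.

Definition sder_ad a (ha : smooth_star a = - a) : star_derivation.
Proof.
refine (@StarDerivation (fun b => a * b - b * a) _ _ _) => [k b c|b c|b].
- by rewrite mulrDr mulrDl -scalerAr -scalerAl scalerBr opprD addrACA.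
- by rewrite mulrBl mulrBr !mulrA addrA subrK.
- by rewrite smooth_starB !smooth_starM ha mulrN mulNr opprK addrC.
Defined.

HB.instance Definition _ := gen_eqMixin star_derivation.
HB.instance Definition _ := gen_choiceMixin star_derivation.

Fact sder_addA : associative sder_add.
Proof. by move=> X Y Z; apply: sder_eq => a /=; rewrite addrA. Qed.
Fact sder_addC : commutative sder_add.
Proof. by move=> X Y; apply: sder_eq => a /=; rewrite addrC. Qed.
Fact sder_add0 : left_id sder_zero sder_add.
Proof. by move=> X; apply: sder_eq => a /=; rewrite add0r. Qed.
Fact sder_addN : left_inverse sder_zero sder_opp sder_add.
Proof. by move=> X; apply: sder_eq => a /=; rewrite addNr. Qed.
HB.instance Definition _ := GRing.isZmodule.Build star_derivation
  sder_addA sder_addC sder_add0 sder_addN.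

Fact sder_scaleA r s X : sder_scale r (sder_scale s X) = sder_scale (r * s) X.
Proof. by apply: sder_eq => a /=; rewrite scalerA rmorphM. Qed.
Fact sder_scale1 : left_id 1 sder_scale.
Proof. by move=> X; apply: sder_eq => a /=; rewrite scale1r. Qed.
Fact sder_scaleDr : right_distributive sder_scale +%R.
Proof. by move=> r X Y; apply: sder_eq => a /=; rewrite scalerDr. Qed.
Fact sder_scaleDl X : {morph sder_scale^~ X : r s / r + s}.
Proof. by move=> r s; apply: sder_eq => a /=; rewrite rmorphD scalerDl. Qed.
HB.instance Definition _ := GRing.Zmodule_isLmodule.Build R star_derivation
  sder_scaleA sder_scale1 sder_scaleDr sder_scaleDl.

Section Partial.
Variable j : 'I_2.
Let sm a : smooth_vector (\val a) := elimT (smoothP _) (valP a).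

Fact smooth_partial_linear : linear (smooth_partial j).
Proof.
move=> k a b; apply: val_inj => /=.
have sk : smooth_vector (k *: \val a) by apply/smoothP; rewrite rpredZ //; exact: valP.
by rewrite (nct_partialD _ sk (sm b)) (nct_partialZ _ _ (sm a)).
Qed.

Fact smooth_partialM a b :
  smooth_partial j (a * b) = smooth_partial j a * b + a * smooth_partial j b.
Proof. by apply: val_inj; rewrite /= (nct_partialM _ (sm a) (sm b)). Qed.

Fact smooth_partial_star a :
  smooth_partial j (smooth_star a) = smooth_star (smooth_partial j a).
Proof. by apply: val_inj; rewrite /= (nct_partial_star _ (sm a)). Qed.

Definition sder_partial : star_derivation :=
  StarDerivation smooth_partial_linear smooth_partialM smooth_partial_star.
End Partial.
End Derivations.

Section Geometry.
Variables (R : realType) (theta : R) (T : nctorus theta).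
Local Notation Aoo := (smooth_torus T).
Local Notation D := (star_derivation T).
Implicit Types (X Y : D) (tau : T -> R[i]).

Definition cstar_positive (A : cstarType R) (a : A) := exists b, a = star b * b.

(* Invertibility is meant in the C*-algebra; by spectral invariance the inverse
   of a smooth element is smooth. *)
Definition invertible (A : cstarType R) (a : A) := exists b, a * b = 1 /\ b * a = 1.

(* [s = a^{-1/2}] for positive invertible [a]: such an [s] is unique, and it is
   smooth by stability under holomorphic functional calculus. *)
Definition is_inv_sqrt (a s : Aoo) :=
  [/\ cstar_positive (smooth_val s), s * s * a = 1 & a * (s * s) = 1].

Definition cstar_simple (A : cstarType R) :=
  forall I : set (real_space A), closed I -> I 0 ->
    (forall x y, I x -> I y -> I (x + y)) ->
    (forall (a : A) (x : A), I x -> I (a * x) /\ I (x * a)) ->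
    I = [set 0] \/ I = setT.

(* The form in which generic transcendence of [theta] is used. The derivation [Z]
   ranges over the inner *-derivations. *)
Definition generic_torus :=
  cstar_simple T /\
  forall X, exists (r1 r2 : R) (Z : D),
    (exists b : Aoo, forall c, Z c = b * c - c * b) /\
    X = r1 *: sder_partial T ord0 + r2 *: sder_partial T ord_max + Z.

(* A state is a positive functional of norm one; [0 <= z] in [R[i]] means that
   [z] is real and nonnegative. *)
Definition tracial_state tau :=
  [/\ scalar tau,
      forall a, 0 <= tau (star a * a),
      tau 1 = 1 /\ forall a, `|tau a| <= (cnorm a)%:C
    & forall a b, tau (a * b) = tau (b * a)].

Definition canonical_trace tau :=
  [/\ tracial_state tau,
      forall a, tau (star a * a) = 0 -> a = 0
    & forall t a, tau (torus_act t a) = tau a].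

(* Row vectors form a left [Aoo]-module; a real scalar [r] acts through
   [r%:C%:A : Aoo]. *)
Definition chi := 'rV[Aoo]_2.
Definition frame (j : 'I_2) : chi := delta_mx 0 j.

Definition pairing (g : 'M[Aoo]_2) (Y Z : chi) : Aoo :=
  \sum_j \sum_k Y 0 j * g j k * smooth_star (Z 0 k).

Record is_connection (nabla : D -> chi -> chi) : Prop := IsConnection {
  connection_linearl : forall (r : R) X X' (Y : chi),
    nabla (r *: X + X') Y = r%:C%:A *: nabla X Y + nabla X' Y;
  connection_linearr : forall X (r : R) (Y Y' : chi),
    nabla X (r%:C%:A *: Y + Y') = r%:C%:A *: nabla X Y + nabla X Y';
  connection_leibniz : forall X (a : Aoo) (Y : chi),
    nabla X (a *: Y) = X a *: Y + a *: nabla X Y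
}.

Record is_levi_civita tau (g : 'M[Aoo]_2) (nabla : D -> chi -> chi) : Prop := IsLeviCivita {
  levi_civita_connection : is_connection nabla;
  levi_civita_metric : forall X (Y Z : chi),
    X (pairing g Y Z) = pairing g (nabla X Y) Z + pairing g Y (nabla X Z);
  levi_civita_torsion : forall j k,
    nabla (sder_partial T j) (frame k) = nabla (sder_partial T k) (frame j);
  levi_civita_self_adjoint : forall j k l,
    smooth_star (pairing g (nabla (sder_partial T j) (frame k)) (frame l))
    = pairing g (nabla (sder_partial T j) (frame k)) (frame l);
  levi_civita_inner : forall (a : Aoo) (ha : smooth_star a = - a), tau (smooth_val a) = 0 ->
    forall Y : chi, nabla (sder_ad ha) Y = a *: Y
}.

Definition curvature (nabla : D -> chi -> chi) X Y (Z : chi) : chi :=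
  nabla Y (nabla X Z) - nabla X (nabla Y Z) + nabla (sder_bracket X Y) Z.

(* [g_jk = delta_jk a_k] *)
Definition diag_metric (a : 'I_2 -> Aoo) : 'M[Aoo]_2 :=
  \matrix_(j, k) (if j == k then a k else 0).

Definition curvature1212 (g : 'M[Aoo]_2) (nabla : D -> chi -> chi) : Aoo :=
  pairing g
    (curvature nabla (sder_partial T ord0) (sder_partial T ord_max) (frame ord0))
    (frame ord_max).
End Geometry.

(* Main.v *)
Require Import Defs.
From HB Require Import structures.
From mathcomp Require Import all_boot all_order all_algebra.
From mathcomp Require Import all_classical all_reals.
From mathcomp Require Import topology normedtype derive complex.
Set Implicit Arguments. Unset Strict Implicit. Unset Printing Implicit Defensive.
Import Order.TTheory GRing.Theory Num.Theory.
Import numFieldNormedType.Exports.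
Local Open Scope ring_scope.
Local Open Scope complex_scope.

(** Write [A = a_1], [B = a_2], [p = A^{-1/2}], [q = B^{-1/2}]. Koszul's formula gives
    [4 R_1212 = (d2A B^-1 d2B + d2A A^-1 d2A - 2 d2d2A)
              + (d1A A^-1 d1B + d1B B^-1 d1B - 2 d1d1B)],
    once the partial derivatives are known to commute. As [tau] vanishes on
    derivatives, the second order terms of [tau (q p 4 R_1212)] can be integrated by
    parts against [q p]. In case (i), [p] commutes with [dA] and [2 dp = - p^3 dA],
    because [y |-> p y + y p] is injective by faithfulness of [tau]; likewise for [q],
    and each bracket cancels under the trace. In case (ii), [q p = 1] and the cyclicity
    of [tau] suffices. *)

(** * Commuting partial derivatives and integration by parts against the trace *)

Section PartialDerivatives.
Variables (R : realType) (theta : R) (T : nctorus theta).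
Local Notation e_ j := (delta_mx 0 j : 'rV[R]_2).

(** The quotient is an element of the torus in its own right, and smooth when [a] is, so that
    integration by parts applies to it before [h] tends to 0. *)
Definition orbit_quotient (j : 'I_2) (a : T) (h : R) : real_space T :=
  h^-1 *: (orbit_map a (h *: e_ j) - (a : real_space T)).

Lemma cvg_orbit_quotient j a : smooth_vector a ->
  (orbit_quotient j a h @[h --> 0^'] --> (nct_partial j a : real_space T))%classic.
Proof.
move=> sa; have := @smooth_vector_derivable _ _ _ a 0 j sa.
rewrite /derivable /nct_partial /derive.
have -> // : (fun h : R => h^-1 *: ((orbit_map a \o shift 0) (h *: e_ j) - orbit_map a 0))
  = orbit_quotient j a.
apply/funext => h.
by rewrite /orbit_quotient /= addr0 [orbit_map a 0]/orbit_map torus_act0.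
Qed.

(** The acting group is commutative. This is what makes the partial derivatives commute with
    [torus_act]. *)
Lemma orbit_map_torus_act s (a : T) :
  orbit_map (torus_act s a) = (torus_act s : real_space T -> real_space T) \o orbit_map a.
Proof. by apply/funext => t; rewrite /orbit_map /= -!torus_actD addrC. Qed.

Lemma smooth_torus_act s (a : T) : smooth_vector a -> smooth_vector (torus_act s a).
Proof.
move=> sa n; rewrite orbit_map_torus_act.
exact: (class_C_lin (real_linear (torus_act_hom T s))
  (star_hom_contractive (torus_act_hom T s)) (sa n)).
Qed.

Lemma nct_partial_torus_act j s (a : T) : smooth_vector a ->
  nct_partial j (torus_act s a) = torus_act s (nct_partial j a).
Proof.
move=> sa; rewrite /nct_partial orbit_map_torus_act.
have dF := @smooth_vector_derivable _ _ _ a 0 j sa.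
by have [_ ->] := is_derive_lin (real_linear (torus_act_hom T s))
  (star_hom_contractive (torus_act_hom T s)) dF.
Qed.

Lemma smooth_vectorZ (k : R[i]) (a : T) : smooth_vector a -> smooth_vector (k *: a).
Proof. by move=> /smoothP sa; apply/smoothP; rewrite rpredZ. Qed.

Lemma smooth_vectorB (a b : T) :
  smooth_vector a -> smooth_vector b -> smooth_vector (a - b).
Proof. by move=> /smoothP sa /smoothP sb; apply/smoothP; rewrite rpredB. Qed.

Lemma nct_partialB j (a b : T) : smooth_vector a -> smooth_vector b ->
  nct_partial j (a - b) = nct_partial j a - nct_partial j b.
Proof.
move=> sa sb; rewrite -(@scaleN1r R[i] T b) nct_partialD //; last exact: smooth_vectorZ.
by rewrite nct_partialZ // scaleN1r.
Qed.

Lemma smooth_orbit_quotient j (a : T) h : smooth_vector a ->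
  smooth_vector (orbit_quotient j a h : T).
Proof.
by move=> sa; apply/smooth_vectorZ/smooth_vectorB => //; exact: smooth_torus_act.
Qed.

Lemma nct_partial_orbit_quotient i j (a : T) h : smooth_vector a ->
  nct_partial i (orbit_quotient j a h : T) = orbit_quotient j (nct_partial i a) h.
Proof.
move=> sa; have sh := smooth_torus_act (h *: e_ j) sa.
rewrite /orbit_quotient !real_scaleE nct_partialZ; last exact: smooth_vectorB.
by congr (_ *: _); rewrite nct_partialB // nct_partial_torus_act.
Qed.

Variables (tau : T -> R[i]) (htau : canonical_trace tau).

Lemma trace_scalar : scalar tau. Proof. by case: htau => [[]]. Qed.
Lemma traceC a b : tau (a * b) = tau (b * a). Proof. by case: htau => [[]]. Qed.
Lemma traceD a b : tau (a + b) = tau a + tau b.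
Proof. by have := trace_scalar 1 a b; rewrite scale1r mul1r. Qed.
Lemma trace0 : tau 0 = 0.
Proof. by apply: (addrI (tau 0)); rewrite -traceD !addr0. Qed.
Lemma traceZ k a : tau (k *: a) = k * tau a.
Proof. by have := trace_scalar k a 0; rewrite !addr0 trace0 addr0. Qed.
Lemma traceN a : tau (- a) = - tau a.
Proof. by rewrite -scaleN1r traceZ mulN1r. Qed.
Lemma traceB a b : tau (a - b) = tau a - tau b.
Proof. by rewrite traceD traceN. Qed.
Lemma trace_star_mul_ge0 (a : T) : 0 <= tau (star a * a).
Proof. by case: htau => [[]]. Qed.
Lemma trace_faithful (a : T) : tau (star a * a) = 0 -> a = 0.
Proof. by case: htau => _ + _; apply. Qed.

(** Continuity of [tau], from the state bound [|tau x| <= cnorm x], in the only form used below. *)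
Lemma trace_cvg0 (U : Type) (P : set_system U) {FP : ProperFilter P}
    (f : U -> real_space T) (l : real_space T) :
  (f x @[x --> P] --> l)%classic -> (forall x, tau (f x) = 0) -> tau l = 0.
Proof.
move=> fl f0; apply/eqP; rewrite -normr_eq0; apply/eqP.
(* The modulus is a complex number; writing it as an embedded real moves the estimate by an
   arbitrary [e] to [R]. *)
have [n nE] : exists n : R, `|tau l| = n%:C by rewrite normc_def; eexists.
rewrite nE; suff n0 : n <= 0.
  have : 0 <= n%:C by rewrite -nE normr_ge0.
  by rewrite lecR => n0'; congr (_%:C); apply/le_anti; rewrite n0 n0'.
apply/ler_addgt0Pr => e e0; rewrite add0r -lecR -nE.
have /cvgrPdist_lt/(_ e e0)/(@filter_ex _ _ FP)[x xe] := fl.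
have -> : tau l = tau ((l : T) - f x) by rewrite traceB f0 subr0.
have [[_ _ [_ +] _] _ _] := htau => /(_ ((l : T) - f x)) /le_trans; apply.
by rewrite lecR; exact: ltW.
Qed.

(** By invariance of [tau], every difference quotient already has trace zero. *)
Lemma trace_partial j (a : T) : smooth_vector a -> tau (nct_partial j a) = 0.
Proof.
move=> sa; apply: trace_cvg0 (cvg_orbit_quotient (j := j) sa) _ => h.
rewrite /orbit_quotient real_scaleE traceZ traceB.
by have [_ _ ->] := htau; rewrite subrr mulr0.
Qed.

Lemma trace_partial_by_parts j (a b : T) : smooth_vector a -> smooth_vector b ->
  tau (nct_partial j a * b) = - tau (a * nct_partial j b).
Proof.
move=> sa sb; apply/eqP; rewrite -addr_eq0 -traceD -nct_partialM //.
by rewrite trace_partial //; exact: smoothM.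
Qed.

(* Integration by parts moves [d_i] off the difference quotients of the orbit in
   direction [j], so the commutator is orthogonal to every smooth vector. *)
Lemma nct_partialC i j (a : T) : smooth_vector a ->
  nct_partial i (nct_partial j a) = nct_partial j (nct_partial i a).
Proof.
move=> sa.
have sp k (b : T) : smooth_vector b -> smooth_vector (nct_partial k b).
  exact: smooth_vector_partial.
have ort c : smooth_vector c ->
    tau (c * (nct_partial i (nct_partial j a) - nct_partial j (nct_partial i a))) = 0.
  move=> sc.
  have : tau (nct_partial i c * nct_partial j a + c * nct_partial j (nct_partial i a)) = 0.
    apply: (@trace_cvg0 _ (dnbhs (0 : R)) _ (fun h =>
      rmul (nct_partial i c) (orbit_quotient j a h)
      + rmul c (orbit_quotient j (nct_partial i a) h))).
      apply: cvgD; apply: cvg_rmul; try exact: cvg_cst.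
        exact: cvg_orbit_quotient.
      by apply: cvg_orbit_quotient; exact: sp.
    move=> h; have sq := smooth_orbit_quotient j h sa.
    rewrite -nct_partial_orbit_quotient // traceD /rmul.
    by rewrite (trace_partial_by_parts i sc sq) addNr.
  rewrite traceD (trace_partial_by_parts i sc (sp j _ sa)).
  move: (nct_partial i (nct_partial j a)) (nct_partial j (nct_partial i a)) => x y H.
  by rewrite mulrBr traceB; move/eqP: H; rewrite addrC subr_eq0 => /eqP ->; rewrite subrr.
apply/eqP; rewrite -subr_eq0; apply/eqP/trace_faithful/ort/smooth_vector_star.
by apply: smooth_vectorB; apply/sp/sp.
Qed.
End PartialDerivatives.

(** * Trace identities for a derivation on an abstract ring *)

Section TraceAlgebra.
Variables (S : nzRingType) (K : zmodType) (t : {additive S -> K}).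
Hypothesis tC : forall x y, t (x * y) = t (y * x).
Implicit Types (A B P Q p q x y : S).

Lemma commute_inverse A P x : P * A = 1 -> A * P = 1 -> A * x = x * A -> P * x = x * P.
Proof.
by move=> PA AP Ax; rewrite -[in LHS](mulr1 x) -AP 2!mulrA -(mulrA P) -Ax mulrA PA mul1r.
Qed.

Section Derivation.
Variable d : S -> S.
Hypothesis dM : forall x y, d (x * y) = d x * y + x * d y.
Hypothesis td : forall x, t (d x) = 0.

Let d1 : d 1 = 0.
Proof. by apply: (addrI (d 1)); rewrite addr0 -[in RHS](mulr1 1) dM mulr1 mul1r. Qed.

Lemma derivation_inverse A P : P * A = 1 -> A * P = 1 -> d P = - (P * d A * P).
Proof.
move=> PA AP; apply/eqP; rewrite -addr_eq0 -[d P]mul1r -PA -!mulrA -mulrDr.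
by rewrite [A * d P + _]addrC -dM AP d1 mulr0.
Qed.

(** With [P = p * p], the map [y |-> p y + y p] sends [[p, dA]] to [[P, dA] = 0], and
    [2 dp + p P dA] to [2 (dP + P P dA)], which vanishes because [dP = - P dA P]. *)
Lemma derivation_inv_sqrt A p : p * p * A = 1 -> A * (p * p) = 1 ->
    A * d A = d A * A -> (forall y, p * y + y * p = 0 -> y = 0) ->
  p * d A = d A * p /\ d p *+ 2 = - (p * (p * p) * d A).
Proof.
move=> PA AP Ax inj; set x := d A in Ax *; set P := p * p in PA AP *.
have Px : P * x = x * P by exact: commute_inverse Ax.
have px : p * x = x * p.
  apply/eqP; rewrite -subr_eq0; apply/eqP/inj.
  by rewrite mulrBr mulrBl !mulrA addrA subrK -/P Px /P mulrA subrr.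
split=> //; apply/eqP; rewrite -addr_eq0; apply/eqP/inj.
have pP : p * P = P * p by rewrite /P mulrA.
have dP : d p * p + p * d p = - (P * x * P) by rewrite -dM (derivation_inverse PA AP).
have e1 : p * (p * P * x) = P * P * x by rewrite !mulrA.
have e2 : p * P * x * p = P * P * x by rewrite -mulrA -px mulrA pP -(mulrA P p).
rewrite mulrDr mulrDl e1 e2 addrACA -mulr2n mulrnAl mulrnAr -mulrnDl -mulrnDl.
by rewrite [p * _ + _]addrC dP -(mulrA P x) -Px mulrA addNr mul0rn.
Qed.

(** Case (ii), with [B = P] and [B^-1 = A]. Substituting [dP = - P dA P] leaves two words of
    opposite sign that are cyclic permutations of each other. *)
Lemma trace_curvature_inverse A P : P * A = 1 -> A * P = 1 ->
  t (d A * A * d P + d A * P * d A - d (d A) *+ 2) = 0 /\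
  t (d A * P * d P + d P * A * d P - d (d P) *+ 2) = 0.
Proof.
move=> PA AP; have dP := derivation_inverse PA AP.
rewrite !raddfB !raddfMn /= !td oppr0 mul0rn !addr0 !raddfD dP; set x := d A.
rewrite !(mulrN, mulNr) opprK !raddfN /= !mulrA; split.
  by rewrite -(mulrA x A P) AP mulr1 -(mulrA x x) (tC x (x * P)) addNr.
rewrite -(mulrA (P * x) P A) PA mulr1 -(mulrA (P * x * P) x P) (tC _ (x * P)).
by rewrite !mulrA addNr.
Qed.

Variables (A B P Q p q : S).
Hypothesis dp : d p *+ 2 = - (p * P * d A).
Hypothesis dq : d q *+ 2 = - (q * Q * d B).

(** Expand [t (d (q p y)) = 0]. Doubling makes [dp] and [dq] appear only in the form given by the
    hypotheses. *)
Lemma trace_weighted_by_parts y :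
  t (q * p * d y *+ 2) = t (q * Q * d B * p * y + q * p * P * d A * y).
Proof.
have dqp : d (q * p * y) = d q * p * y + q * d p * y + q * p * d y.
  by rewrite !dM mulrDl.
have : t (d (q * p * y) *+ 2) = 0 by rewrite raddfMn /= td mul0rn.
have -> : d (q * p * y) *+ 2 = (d q *+ 2) * p * y + q * (d p *+ 2) * y + q * p * d y *+ 2.
  by rewrite dqp !mulrnDl !mulrnAl mulrnAr mulrnAl.
rewrite dq dp mulrN !mulNr -opprD addrC raddfB /=.
by move=> /eqP; rewrite subr_eq0 !mulrA => /eqP.
Qed.

Hypothesis xP : d A * P = P * d A.

(** After integration by parts, the terms containing [P] cancel by [xP]. The others agree by moving
    [Q dB] cyclically to the front and commuting it with [q]. *)
Lemma trace_curvature_first : q * Q * d B = Q * d B * q ->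
  t (p * (d A * Q * d B + d A * P * d A - d (d A) *+ 2) * q) = 0.
Proof.
move=> qQy; rewrite tC mulrA mulrBr raddfB /= mulrnAr trace_weighted_by_parts.
rewrite mulrDr !raddfD /= xP !mulrA -opprD.
suff -> : t (q * p * d A * Q * d B) = t (q * Q * d B * p * d A) by rewrite subrr.
by rewrite -(mulrA _ Q) tC qQy !mulrA.
Qed.

(** The same cancellation, now with the second order term in [B]: the weight [q p] still yields one
    term with [P dA] and one with [Q dB]. *)
Lemma trace_curvature_second : q * Q * d B = Q * d B * q ->
  t (p * (d A * P * d B + d B * Q * d B - d (d B) *+ 2) * q) = 0.
Proof.
move=> qQy; rewrite tC mulrA mulrBr raddfB /= mulrnAr trace_weighted_by_parts.
rewrite mulrDr !raddfD /= xP !mulrA -opprD [X in _ - X]addrC.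
suff -> : t (q * p * d B * Q * d B) = t (q * Q * d B * p * d B) by rewrite subrr.
by rewrite -!(mulrA q) [LHS]tC !mulrA -2!mulrA (mulrA Q) -qQy [LHS]tC !mulrA.
Qed.

End Derivation.
End TraceAlgebra.

(** * Injectivity of operator equations from faithfulness of the trace *)

Section FaithfulTrace.
Variables (R : realType) (theta : R) (T : nctorus theta).
Variables (tau : T -> R[i]) (htau : canonical_trace tau).
Local Notation Aoo := (smooth_torus T).

(** For [p = b^* b] and [q = c^* c], cyclicity makes this the trace of [z^* z] with
    [z = b y c^*]. *)
Lemma trace_sandwich_ge0 (p q y : T) : cstar_positive p -> cstar_positive q ->
  0 <= tau (star y * p * y * q).
Proof.
move=> [b ->] [c ->]; have := trace_star_mul_ge0 htau (b * y * star c).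
by rewrite !starM starK -!mulrA (traceC htau c) !mulrA.
Qed.

Lemma cstar_positive1 : cstar_positive (1 : T).
Proof. by exists 1; rewrite star1 mulr1. Qed.

(** Multiply by [y^*] and take the trace: both terms are nonnegative, so both vanish. With
    [p = b^* b], faithfulness gives [b y = 0], hence [p y = 0]. *)
Lemma sylvester_injective (p r y : T) : cstar_positive p -> r * p = 1 ->
  p * y + y * p = 0 -> y = 0.
Proof.
move=> hp rp E; have h1 := cstar_positive1.
have := trace_sandwich_ge0 y hp h1; have := trace_sandwich_ge0 y h1 hp.
rewrite !mulr1 => H1 H2.
have : tau (star y * p * y) + tau (star y * y * p) = 0.
  by rewrite -(traceD htau) -!mulrA -mulrDr E mulr0 (trace0 htau).
move=> /eqP; rewrite paddr_eq0 // => /andP[/eqP + _].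
case: hp rp E H1 H2 => b -> rp _ _ _.
rewrite mulrA -mulrA -starM => /(trace_faithful htau) by0.
by rewrite -[y]mul1r -rp -!mulrA by0 !mulr0.
Qed.

(** The same positivity argument, in which one of the two vanishing terms is [tau (y^* y)]. It will
    identify the product of the two inverse roots in case (ii). *)
Lemma stein_injective (p q y : T) : cstar_positive p -> cstar_positive q ->
  p * y * q + y = 0 -> y = 0.
Proof.
move=> hp hq E; apply: (trace_faithful htau).
have := trace_sandwich_ge0 y hp hq; have := trace_star_mul_ge0 htau y => H1 H2.
have : tau (star y * p * y * q) + tau (star y * y) = 0.
  by rewrite -(traceD htau) -!mulrA -mulrDr !mulrA E mulr0 (trace0 htau).
by move=> /eqP; rewrite paddr_eq0 // => /andP[_ /eqP].
Qed.

(** The proof is an argument so that additivity, which depends on it, can be attached as an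
    instance. *)
Definition smooth_trace of canonical_trace tau := fun a : Aoo => tau (smooth_val a).
Local Notation t := (smooth_trace htau).

Fact smooth_trace_is_zmod_morphism : zmod_morphism t.
Proof. by move=> a b; exact: (traceB htau). Qed.
HB.instance Definition _ := GRing.isZmodMorphism.Build Aoo R[i] t smooth_trace_is_zmod_morphism.

Lemma smooth_traceC (a b : Aoo) : t (a * b) = t (b * a).
Proof. exact: (traceC htau). Qed.

Lemma smooth_trace_partial j (a : Aoo) : t (sder_partial T j a) = 0.
Proof. exact/(trace_partial htau)/smoothP/valP. Qed.

Lemma sder_bracket_partial i j : sder_bracket (sder_partial T i) (sder_partial T j) = 0.
Proof.
apply: sder_eq => a; apply: val_inj => /=.
by rewrite (nct_partialC htau i j) ?subrr //; exact/smoothP/valP.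
Qed.

End FaithfulTrace.

(** * Christoffel symbols and curvature of a diagonal metric *)

Section DiagonalLeviCivita.
Variables (R : realType) (theta : R) (T : nctorus theta).
Local Notation Aoo := (smooth_torus T).
Local Notation partial := (sder_partial T).
Implicit Types (Y Z : chi T).

Lemma smooth_star0 : smooth_star (0 : Aoo) = 0.
Proof. by apply: val_inj; rewrite /= star0. Qed.

Lemma smooth_star1 : smooth_star (1 : Aoo) = 1.
Proof. by apply: val_inj; rewrite /= star1. Qed.

Lemma pairing_addl (g : 'M[Aoo]_2) Y Y' Z :
  pairing g (Y + Y') Z = pairing g Y Z + pairing g Y' Z.
Proof.
rewrite /pairing -big_split; apply: eq_bigr => j _; rewrite -big_split.
by apply: eq_bigr => k _; rewrite mxE !mulrDl.
Qed.

Lemma pairing_oppl (g : 'M[Aoo]_2) Y Z : pairing g (- Y) Z = - pairing g Y Z.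
Proof.
rewrite /pairing -sumrN; apply: eq_bigr => j _; rewrite -sumrN.
by apply: eq_bigr => k _; rewrite mxE !mulNr.
Qed.

Variable a : 'I_2 -> Aoo.
Local Notation g := (diag_metric a).

Lemma pairing_diag Y Z : pairing g Y Z = \sum_j Y 0 j * a j * smooth_star (Z 0 j).
Proof.
apply: eq_bigr => j _; rewrite (bigD1 j) //= mxE eqxx big1 ?addr0 // => k.
by rewrite mxE eq_sym => /negPf ->; rewrite mulr0 mul0r.
Qed.

Lemma pairing_frame Y k : pairing g Y (frame T k) = Y 0 k * a k.
Proof.
rewrite pairing_diag (bigD1 k) //= mxE !eqxx smooth_star1 mulr1 big1 ?addr0 // => j jk.
by rewrite mxE (negPf jk) smooth_star0 mulr0.
Qed.

Hypothesis a_sa : forall j, smooth_star (a j) = a j.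

Lemma pairing_framel k Z : pairing g (frame T k) Z = smooth_star (pairing g Z (frame T k)).
Proof.
rewrite pairing_frame smooth_starM a_sa pairing_diag (bigD1 k) //= mxE !eqxx mul1r.
by rewrite big1 ?addr0 // => j jk; rewrite mxE (negPf jk) !mul0r.
Qed.

(** Coordinates are recovered from pairings with the frame, so the curvature can be written in
    Christoffel symbols alone. *)
Lemma pairing_diagE (P : 'I_2 -> Aoo) Y Z :
    (forall j, P j * a j = 1) -> (forall j, a j * P j = 1) ->
  pairing g Y Z =
    \sum_j pairing g Y (frame T j) * P j * smooth_star (pairing g Z (frame T j)).
Proof.
move=> Pa aP; rewrite pairing_diag; apply: eq_bigr => j _.
rewrite !pairing_frame smooth_starM a_sa -[Y 0 j * a j * P j]mulrA aP mulr1.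
by rewrite mulrA.
Qed.

Variables (tau : T -> R[i]) (nabla : star_derivation T -> chi T -> chi T).
Hypothesis hnabla : is_levi_civita tau g nabla.

Local Notation G j k l := (pairing g (nabla (partial j) (frame T k)) (frame T l)).

(** Metric compatibility on the frame; self-adjointness of the symbols removes the star from the
    second term. *)
Lemma christoffel_metric j k l : G j k l + G j l k = partial j (g k l).
Proof.
have -> : g k l = pairing g (frame T k) (frame T l).
  by rewrite pairing_frame !mxE eqxx eq_sym; case: eqVneq => _; rewrite ?mul1r ?mul0r.
rewrite (levi_civita_metric hnabla) pairing_framel.
by rewrite (levi_civita_self_adjoint hnabla).
Qed.

Lemma koszul j k l :
  G j k l *+ 2 = partial j (g k l) + partial k (g j l) - partial l (g j k).
Proof.
have tor i m : nabla (partial i) (frame T m) = nabla (partial m) (frame T i).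
  exact: levi_civita_torsion hnabla i m.
rewrite -!christoffel_metric (tor k j) (tor l j) (tor l k).
by rewrite addrACA -mulr2n addrK.
Qed.

(** This reduces a second covariant derivative to a derivative of a symbol and a pairing of two
    first ones. *)
Lemma pairing_nabla X Y Z :
  pairing g (nabla X Y) Z = X (pairing g Y Z) - pairing g Y (nabla X Z).
Proof. by rewrite (levi_civita_metric hnabla) addrK. Qed.

Lemma nabla0 Y : nabla 0 Y = 0.
Proof.
have := connection_linearl (levi_civita_connection hnabla) 1 0 0 Y.
rewrite scaler0 addr0 rmorph1 !scale1r => E.
by apply: (addrI (nabla 0 Y)); rewrite addr0 -E.
Qed.

Variable P : 'I_2 -> Aoo.
Hypothesis Pa : forall j, P j * a j = 1.
Hypothesis aP : forall j, a j * P j = 1.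
Hypothesis htau : canonical_trace tau.
Local Notation d1 := (partial ord0).
Local Notation d2 := (partial ord_max).
Local Notation A := (a ord0).
Local Notation B := (a ord_max).

Lemma curvature1212_diag : curvature1212 g nabla *+ 4 =
  (d2 A * P ord_max * d2 B + d2 A * P ord0 * d2 A - d2 (d2 A) *+ 2) +
  (d1 A * P ord0 * d1 B + d1 B * P ord_max * d1 B - d1 (d1 B) *+ 2).
Proof.
have gE j k : g j k = if j == k then a k else 0 by rewrite mxE.
have E j k l : G j k l *+ 2 = partial j (g k l) + partial k (g j l) - partial l (g j k).
  exact: koszul.
have ne1 : (ord0 == ord_max :> 'I_2) = false by [].
have ne2 : (ord_max == ord0 :> 'I_2) = false by [].
(* The 4 doubles each of the two symbols in a product, so that [koszul] applies without division. *)
have pp j k j' k' : pairing g (nabla (partial j) (frame T k)) (nabla (partial j') (frame T k'))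
    *+ 4 = (G j k ord0 *+ 2) * P ord0 * (G j' k' ord0 *+ 2)
        + (G j k ord_max *+ 2) * P ord_max * (G j' k' ord_max *+ 2).
  rewrite (pairing_diagE _ _ Pa aP) big_ord_recl big_ord1.
  have -> : lift ord0 ord0 = ord_max :> 'I_2 by apply: val_inj.
  by rewrite !(levi_civita_self_adjoint hnabla) !mulrnAr !mulrnAl -!mulrnA -mulrnDl.
rewrite /curvature1212 /curvature (sder_bracket_partial htau) nabla0 addr0.
rewrite pairing_addl pairing_oppl.
rewrite (pairing_nabla d2 (nabla d1 _)) (pairing_nabla d1 (nabla d2 _)).
rewrite opprB !mulrnDl !mulNrn !pp ![_ *+ 4](mulrnA _ 2 2).
have dE (X : star_derivation T) (x : Aoo) : X x *+ 2 = X (x *+ 2).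
  by rewrite !mulr2n sderD.
(* With indices 1 and 2, the doubled symbols are [G111 = d1 A], [G112 = - d2 A],
   [G121 = G211 = d2 A], [G122 = G212 = d1 B], [G221 = - d1 B] and [G222 = d2 B]. *)
rewrite !dE !E !gE !eqxx ne1 ne2 !sder0 !(addr0, add0r, subr0, sub0r, addrK).
rewrite mulNrn sderN -!dE mulrN !mulNr (opprB (- _) (_ * d2 B)) opprK.
by rewrite [LHS](AC ((1*2)*3) (((2*4)*1)*((3*5)*6))).
Qed.
End DiagonalLeviCivita.

(** * Vanishing of the total curvature *)

Theorem mainTheorem3 (R : realType) (theta : R) (T : nctorus theta)
    (hT : generic_torus T)
    (tau : T -> R[i]) (htau : canonical_trace tau)
    (a : 'I_2 -> smooth_torus T)
    (ha : forall j, cstar_positive (smooth_val (a j)) /\ invertible (smooth_val (a j)))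
    (s : 'I_2 -> smooth_torus T)
    (hs : forall j, is_inv_sqrt (a j) (s j))
    (nabla : star_derivation T -> chi T -> chi T)
    (hnabla : is_levi_civita tau (diag_metric a) nabla)
    (hyp : (forall j k, a j * sder_partial T k (a j) = sder_partial T k (a j) * a j)
           \/ a ord0 * a ord_max = 1) :
  tau (smooth_val (s ord0 * curvature1212 (diag_metric a) nabla * s ord_max)) = 0.
Proof.
have a_sa j : smooth_star (a j) = a j.
  by apply: val_inj; have [[b /= ->] _] := ha j; rewrite starM starK.
have sp j : cstar_positive (smooth_val (s j)) by case: (hs j).
have Pa j : s j * s j * a j = 1 by case: (hs j).
have aP j : a j * (s j * s j) = 1 by case: (hs j).
pose t : {additive smooth_torus T -> R[i]} := smooth_trace htau.
have tC : forall x y, t (x * y) = t (y * x) := smooth_traceC htau.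
have td k x : t (sder_partial T k x) = 0 by exact: smooth_trace_partial.
have dM k := @sderM _ _ _ (sder_partial T k).
change (t (s ord0 * curvature1212 (diag_metric a) nabla * s ord_max) = 0).
have t4 x : t (x *+ 4) = 0 -> t x = 0.
  by rewrite raddfMn => /eqP; rewrite mulrn_eq0 => /eqP.
apply: t4; rewrite -mulrnAl -mulrnAr.
rewrite (curvature1212_diag a_sa hnabla Pa aP htau).
case: hyp => [comm|a01].
- have inj j (y : smooth_torus T) : s j * y + y * s j = 0 -> y = 0.
    move=> /(congr1 (@smooth_val _ _ _)) E; apply: val_inj.
    (* The left inverse comes from [a_j s_j s_j = 1]. *)
    apply: (sylvester_injective htau (sp j) (r := smooth_val (a j * s j))) E.
    by rewrite -[LHS]/(smooth_val (a j * s j * s j)) -mulrA aP.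
  have H k j := derivation_inv_sqrt (dM k) (Pa j) (aP j) (comm j k) (@inj j).
  have sP k j : sder_partial T k (a j) * (s j * s j) = s j * s j * sder_partial T k (a j).
    by have [E _] := H k j; rewrite mulrA -E -[LHS]mulrA -E mulrA.
  have sPs k : s ord_max * (s ord_max * s ord_max) * sder_partial T k (a ord_max)
      = s ord_max * s ord_max * sder_partial T k (a ord_max) * s ord_max.
    by have [E _] := H k ord_max; rewrite -[RHS]mulrA -E !mulrA.
  rewrite mulrDr mulrDl raddfD.
  have [[_ p2] [_ q2]] := (H ord_max ord0, H ord_max ord_max).
  have [[_ p1] [_ q1]] := (H ord0 ord0, H ord0 ord_max).
  have -> := trace_curvature_first tC (dM ord_max) (td ord_max) p2 q2 (sP _ _) (sPs _).
  have -> := trace_curvature_second tC (dM ord0) (td ord0) p1 q1 (sP _ _) (sPs _).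
  by rewrite addr0.
- have E1 : s ord_max * s ord_max = a ord0.
    by rewrite -[RHS]mulr1 -(aP ord_max) mulrA a01 mul1r.
  have E0 : s ord0 * s ord0 = a ord_max.
    by rewrite -[RHS]mul1r -(Pa ord0) -mulrA a01 mulr1.
  (* Put [y = q p - 1]. Then [q y p + y = q q p p - 1 = A B - 1 = 0], so [y = 0]. *)
  have s10 : s ord_max * s ord0 = 1.
    apply/eqP; rewrite -subr_eq0; apply/eqP/val_inj.
    apply: (stein_injective htau (sp ord_max) (sp ord0)).
    suff E : s ord_max * (s ord_max * s ord0 - 1) * s ord0
        + (s ord_max * s ord0 - 1) = 0 by exact: (congr1 (@smooth_val _ _ _) E).
    by rewrite mulrBr mulrBl mulr1 addrA subrK mulrA -mulrA E0 E1 a01 subrr.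
  (* The weight [q p] is now 1, and the two brackets are the two identities of
     [trace_curvature_inverse], the first for [d2] and the second for [d1]. *)
  rewrite tC mulrA s10 mul1r E1 E0 raddfD /=.
  have a10 : a ord_max * a ord0 = 1 by rewrite -E0 Pa.
  have [-> _] := trace_curvature_inverse tC (dM ord_max) (td ord_max) a10 a01.
  by have [_ ->] := trace_curvature_inverse tC (dM ord0) (td ord0) a10 a01; rewrite addr0.
Qed.
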